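(* Fix a real number $\alpha\geq 0$, an integer $c\in\mathbb{Z}$, and a positive integer $k$. Then, for $a\to\infty$ ($a$ a nonnegative integer), $$[q^{\lfloor \alpha a\rfloor-c}]\binom{a+k}{k}_q=\frac{1}{(k-1)!\,k!}\,C(\alpha,k)\,a^{k-1}+O(a^{k-2}),$$ where $$C(\alpha,k)=\sum_{i=0}^{\lfloor\alpha\rfloor}(-1)^i\binom{k}{i}(\alpha-i)^{k-1}.$$
   Context: Here $\binom{a+k}{k}_q=\frac{(1-q^{a+1})(1-q^{a+2})\cdots(1-q^{a+k})}{(1-q)(1-q^2)\cdots(1-q^k)}$ is the $q$-binomial coefficient, a polynomial in $q$, and $[q^n]F(q)$ denotes the coefficient of $q^n$ in $F(q)$ (equal to $0$ if $n<0$ or $n$ exceeds the degree). The binomial coefficient $\binom{k}{i}$ is $0$ for $i>k$. The notation $f(a)=O(g(a))$ for $a\to\infty$ means $|f(a)|\leq M\cdot|g(a)|$ for some constant $M>0$ and all sufficiently large $a$; since $\alpha$, $c$, $k$ are fixed, the constant may depend on them.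
   Formalization: For k = 1 the cases α = 0 with c > 0 and α = 1 with c ≥ 0 are excluded: there (with 0^0 = 1) the coefficient and C(α,1) differ by exactly 1 for large a, so the claimed O(1/a) error fails; all other cases are covered. *)

(* Defs.v *)
From HB Require Import structures.
From mathcomp Require Import all_boot all_order all_algebra.
From mathcomp Require Import all_classical all_reals all_analysis.
Set Implicit Arguments.
Unset Strict Implicit.
Unset Printing Implicit Defensive.
Import Order.TTheory GRing.Theory Num.Theory.
Import numFieldNormedType.Exports.
Local Open Scope ring_scope.

Definition qbinom_num (F : fieldType) (a k : nat) : {poly F} :=
  \prod_(1 <= j < k.+1) (1 - 'X^(a + j)).

Definition qbinom_den (F : fieldType) (k : nat) : {poly F} :=
  \prod_(1 <= j < k.+1) (1 - 'X^j).

(* The q-binomial coefficient (a + k choose k)_q, with q = 'X.  [%/] is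
   Euclidean division of polynomials; it is exact here, see [qbinomK]. *)
Definition qbinom (F : fieldType) (a k : nat) : {poly F} :=
  qbinom_num F a k %/ qbinom_den F k.

Lemma qbinom_den_dvd (F : fieldType) (a k : nat) :
  qbinom_den F k %| qbinom_num F a k.
Proof.
elim: k a => [|k IHk] a; first by rewrite /qbinom_den big_nil dvd1p.
elim: a => [|a IHa]; first by rewrite /qbinom_den /qbinom_num dvdpp.
have numSl : qbinom_num F a k.+1 = (1 - 'X^(a.+1)) * qbinom_num F a.+1 k.
  rewrite /qbinom_num big_nat_recl // addn1 (big_add1 _ _ 0) /=.
  rewrite (big_add1 _ _ 0) /=; congr (_ * _).
  by apply: eq_bigr => i _; rewrite addnS addSn addnS.
have -> : qbinom_num F a.+1 k.+1 =
    qbinom_num F a.+1 k * (1 - 'X^(k.+1)) + 'X^(k.+1) * qbinom_num F a k.+1.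
  rewrite numSl {1}/qbinom_num big_nat_recr //= -/(qbinom_num F a.+1 k).
  rewrite exprD mulrA [_ * qbinom_num _ _ _]mulrC -mulrDr; congr (_ * _).
  by rewrite mulrBr mulr1 addrA subrK [X in 1 - X]mulrC.
apply: dvdp_add; last exact: dvdp_mull IHa.
have -> : qbinom_den F k.+1 = qbinom_den F k * (1 - 'X^(k.+1)).
  by rewrite /qbinom_den big_nat_recr.
exact: dvdp_mul (IHk _) (dvdpp _).
Qed.

Lemma qbinomK (F : fieldType) (a k : nat) :
  qbinom F a k * qbinom_den F k = qbinom_num F a k.
Proof. by rewrite divpK // qbinom_den_dvd. Qed.

Definition coefz (F : fieldType) (p : {poly F}) (n : int) : F :=
  if n is Posz m then p`_m else 0.

(* For alpha >= 0, [Num.truncn alpha] is the floor of alpha as a natural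
   number.  Note that 0 ^+ 0 = 1, which matters only for k = 1. *)
Definition Ccoef (R : realType) (alpha : R) (k : nat) : R :=
  \sum_(0 <= i < (Num.truncn alpha).+1)
     (-1) ^+ i * ('C(k, i))%:R * (alpha - i%:R) ^+ k.-1.

(* Main.v *)
Require Import Defs.
From HB Require Import structures.
From mathcomp Require Import all_boot all_order all_algebra.
From mathcomp Require Import all_classical all_reals all_analysis.
From mathcomp Require Import zify ring lra.
Import Order.TTheory GRing.Theory Num.Theory.
Import numFieldNormedType.Exports.
Local Open Scope classical_set_scope.
Local Open Scope ring_scope.

(** The power series 1 / ((1 - q) ... (1 - q^k)) counts the partitions of n into
parts of size at most k, and this number is n^(k-1) / ((k-1)! k!) up to
O(n^(k-2)).  Multiplying by the numerator (1 - q^(a+1)) ... (1 - q^(a+k)) of the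
q-binomial coefficient applies the k backward differences of steps a+1, ..., a+k
to the coefficient sequence ([coefz_qbinom]).  At the scale n ~ alpha * a each
of those steps moves alpha by one unit, up to a bounded shift of n, which only
costs O(a^(k-2)).  So the leading coefficient becomes the k-th backward
difference with step 1, at alpha, of the truncated power
x |-> max(x, 0)^(k-1), the truncation reflecting that there are no partitions of
a negative number ([bdiffs_asymp], [zparts_asymp]).  Expanding this difference
binomially gives C(alpha, k) ([Ccoef_fdiff]).

The partition asymptotics rest on an explicit sandwich, [nparts_bounds]: up to
the factor (k-1)! k!, the number of partitions lies between n^(k-1) and
(n + k(k+1)/2)^(k-1).  Both bounds propagate through the recurrence
p_k(n) = p_k(n - k) + p_(k-1)(n) by Bernoulli-type inequalities.

This argument needs the truncated power to be Lipschitz on bounded sets, hence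
k >= 2.  For k = 1 the truncated power is a step function with a jump at 0, but
then the polynomial is 1 + q + ... + q^a, and one compares the index with 0 and
a directly; only alpha = 0 and alpha = 1, where the jumps occur, are sensitive
to c ([coefz_qbinom1_near]). *)

(** * Partitions into parts of bounded size *)

(** Number of partitions of n into parts of size at most k; i is the number of
parts equal to k. *)
Fixpoint nparts (k n : nat) : nat :=
  if k is k'.+1 then \sum_(i < (n %/ k).+1) nparts k' (n - i * k) else n == 0.

Lemma npartsD (k n : nat) :
  nparts k.+1 (n + k.+1) = (nparts k.+1 n + nparts k (n + k.+1))%N.
Proof.
rewrite /= divnDr // divnn /= addn1 big_ord_recl mul0n subn0 addnC.
by congr addn; apply: eq_bigr => i _; rewrite /bump /= mulSn addnC subnDl.
Qed.

Lemma nparts_small (k n : nat) : (n < k.+1)%N -> nparts k.+1 n = nparts k n.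
Proof. by move=> lt_nk; rewrite /= divn_small // big_ord1 mul0n subn0. Qed.

Lemma nparts1 (n : nat) : nparts 1 n = 1%N.
Proof.
elim: n => [|n IHn]; first by rewrite nparts_small.
by rewrite -(addn1 n) npartsD IHn addn1.
Qed.

Lemma expn_addl_ge (k x d : nat) :
  (x ^ k.+1 + k.+1 * d * x ^ k <= (x + d) ^ k.+1)%N.
Proof.
elim: k => [|k IHk]; first by rewrite !expn1 expn0; lia.
rewrite [((x + d) ^ _)%N]expnS; apply: leq_trans (leq_mul (leqnn _) IHk).
rewrite (expnS x k.+1) (expnS x k); move: (x ^ k)%N => y; nia.
Qed.

Lemma expn_addl_le (k x d : nat) :
  ((x + d) ^ k.+1 <= x ^ k.+1 + k.+1 * d * (x + d) ^ k)%N.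
Proof.
elim: k => [|k IHk]; first by rewrite !expn1 expn0; lia.
rewrite [((x + d) ^ k.+2)%N]expnS mulnDl (expnS x k.+1).
have {}IHk := leq_mul (leqnn x) IHk.
apply: leq_trans (leq_add IHk (leqnn _)) _.
rewrite (expnS (x + d)); move: (x ^ k.+1)%N ((x + d) ^ k)%N => y z; nia.
Qed.

(** The shift 'C(k.+2, 2) = 1 + ... + k.+1 is chosen so that going from k to
k.+1 raises it by exactly the size of the new part: the recurrence
p(n) = p(n - d) + p'(n) then turns the two upper bounds into (x ^ k.+1) and
(k.+1 * d * x ^ k) for the same x, the first two terms of (x + d) ^ k.+1. *)
Lemma nparts_bounds (k n : nat) :
  (n ^ k <= nparts k.+1 n * (k`! * k.+1`!) <= (n + 'C(k.+2, 2)) ^ k)%N.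
Proof.
elim: k n => [|k IHk] n; first by rewrite nparts1.
have facE : (k.+1`! * k.+2`! = (k`! * k.+1`!) * (k.+1 * k.+2))%N.
  by rewrite (factS k.+1) (factS k); lia.
have -> : 'C(k.+3, 2) = ('C(k.+2, 2) + k.+2)%N by rewrite binS bin1.
elim/ltn_ind: n => n IHn; have [lt_nk|le_kn] := ltnP n k.+2.
  rewrite nparts_small // facE mulnA; case/andP: (IHk n) => lo hi.
  apply/andP; split.
    apply: leq_trans (leq_mul lo (leqnn _)).
    by rewrite expnSr leq_mul2l; apply/orP; right; nia.
  apply: leq_trans (leq_mul hi (leqnn _)) _.
  rewrite addnA mulnC; apply: leq_trans (expn_addl_ge _ _ _).
  exact: leq_addl.
have [m nE] : exists m, n = (m + k.+2)%N by exists (n - k.+2)%N; lia.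
rewrite {}nE in IHn *.
have /IHn /andP[lo1 hi1] : (m < m + k.+2)%N by lia.
case/andP: (IHk (m + k.+2)) => lo2 hi2; rewrite npartsD mulnDl.
apply/andP; split.
  apply: (leq_trans (expn_addl_le _ _ _)); apply: (leq_add lo1).
  by rewrite facE mulnA mulnC leq_mul2r lo2 orbT.
have -> : (m + k.+2 + ('C(k.+2, 2) + k.+2) = m + k.+2 + 'C(k.+2, 2) + k.+2)%N.
  by rewrite addnA.
apply: leq_trans (expn_addl_ge _ _ _).
apply: leq_add; first by apply: leq_trans hi1 _; rewrite addnA addnAC.
by rewrite facE mulnA mulnC leq_mul2l hi2 orbT.
Qed.

(** * Backward differences and the coefficients of the q-binomial *)

Definition zext {V : nmodType} (f : nat -> V) (n : int) : V :=
  if n is Posz m then f m else 0.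

Lemma zext_neg {V : nmodType} (f : nat -> V) (n : int) : n < 0 -> zext f n = 0.
Proof. by case: n. Qed.

Definition bdiff {V : zmodType} (j : nat) (f : int -> V) (n : int) : V :=
  f n - f (n - j%:Z).

Definition bdiffs {V : zmodType} (js : seq nat) (f : int -> V) : int -> V :=
  foldr bdiff f js.

Lemma bdiffC {V : zmodType} (i j : nat) (f : int -> V) :
  bdiff i (bdiff j f) = bdiff j (bdiff i f).
Proof.
by apply/funext => n; rewrite /bdiff (addrAC n (- i%:Z)) !opprD addrACA.
Qed.

Lemma bdiffsC {V : zmodType} (is_ js : seq nat) (f : int -> V) :
  bdiffs is_ (bdiffs js f) = bdiffs js (bdiffs is_ f).
Proof.
have bdiff1C i : forall g : int -> V, bdiff i (bdiffs js g) = bdiffs js (bdiff i g).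
  by elim: js => //= j js IHjs g; rewrite bdiffC IHjs.
by elim: is_ => //= i is_ ->.
Qed.

Lemma bdiffs_neg {V : zmodType} (js : seq nat) (f : int -> V) :
  (forall n, n < 0 -> f n = 0) -> forall n, n < 0 -> bdiffs js f n = 0.
Proof.
move=> f0; elim: js => //= j js IHjs n n_lt0.
by rewrite /bdiff !IHjs ?subr0 //; lia.
Qed.

(** Multiplication by 1 - q^j is injective on formal power series. *)
Lemma bdiff_inj {V : zmodType} (j : nat) (f g : int -> V) : (0 < j)%N ->
    (forall n, n < 0 -> f n = 0) -> (forall n, n < 0 -> g n = 0) ->
  bdiff j f = bdiff j g -> f = g.
Proof.
move=> j_gt0 f0 g0 fg; apply/funext => -[n|n]; last by rewrite f0 ?g0.
elim/ltn_ind: n => n IHn.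
have fgn : f (n%:Z - j%:Z) = g (n%:Z - j%:Z).
  have [le_jn|lt_nj] := leqP j n.
    by rewrite subzn //; apply: IHn; lia.
  by rewrite f0 ?g0 //; lia.
by have := congr1 (@^~ n%:Z) fg; rewrite /bdiff /= fgn => /addIr.
Qed.

Lemma bdiffs_inj {V : zmodType} (js : seq nat) (f g : int -> V) :
    all (ltn 0) js ->
    (forall n, n < 0 -> f n = 0) -> (forall n, n < 0 -> g n = 0) ->
  bdiffs js f = bdiffs js g -> f = g.
Proof.
move=> + f0 g0; elim: js => //= j js IHjs /andP[j_gt0 /IHjs{}IHjs] fg.
by apply/IHjs; apply: bdiff_inj fg => //; apply: bdiffs_neg.
Qed.

Lemma coefz_neg (F : fieldType) (p : {poly F}) (n : int) :
  n < 0 -> coefz p n = 0.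
Proof. by case: n. Qed.

Lemma coefz_prod (F : fieldType) (js : seq nat) (p : {poly F}) :
  coefz (\prod_(j <- js) (1 - 'X^j) * p) = bdiffs js (coefz p).
Proof.
elim: js => [|j js IHjs]; first by rewrite big_nil mul1r.
rewrite big_cons -mulrA /= -IHjs; apply/funext => -[n|n]; last first.
  by rewrite /bdiff /= coefz_neg ?subr0 //; lia.
rewrite /bdiff /= mulrBl mul1r coefB coefXnM; congr (_ - _).
case: ltnP => [lt_nj|le_jn]; last by rewrite subzn.
by rewrite coefz_neg //; lia.
Qed.

Section PartitionSeries.
Variable F : fieldType.

Definition zparts (k : nat) : int -> F := zext (fun n => (nparts k n)%:R).

Lemma bdiff_zparts (k : nat) : bdiff k.+1 (zparts k.+1) = zparts k.
Proof.
apply/funext => n; rewrite /bdiff.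
have [n_lt0|n_ge0] := ltrP n 0; first by rewrite /zparts !zext_neg ?subr0 //; lia.
have [lt_nk|le_kn] := ltrP n k.+1%:Z.
  rewrite [X in _ - X]zext_neg ?subr0; last by lia.
  by case: n n_ge0 lt_nk => // n _ lt_nk; rewrite /zparts /zext nparts_small.
have -> : n = (`|n - k.+1%:Z|%N + k.+1)%N%:Z by lia.
by rewrite PoszD addrK -PoszD /zparts /zext npartsD natrD addrAC subrr add0r.
Qed.

(** The partition numbers are the coefficients of 1 / ((1 - q) ... (1 - q^k)). *)
Lemma bdiffs_zparts (k : nat) :
  bdiffs (iota 1 k) (zparts k) = coefz (1 : {poly F}).
Proof.
elim: k => [|k IHk]; last first.
  by rewrite -[in iota 1 _](addn1 k) iotaD cats1 /bdiffs foldr_rcons add1n bdiff_zparts.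
by apply/funext => -[n|n] //; rewrite /= coef1.
Qed.

(** Both sides have the same image under the differences of steps 1, ..., k,
namely the coefficients of the numerator; those differences are injective. *)
Lemma coefz_qbinom (a k : nat) :
  coefz (qbinom F a k) = bdiffs [seq (a + j)%N | j <- iota 1 k] (zparts k).
Proof.
have pneg n : n < 0 -> zparts k n = 0 by apply: zext_neg.
apply: (@bdiffs_inj _ (iota 1 k)); first by apply/allP => j; rewrite mem_iota => /andP[].
- exact: coefz_neg.
- exact: bdiffs_neg.
rewrite bdiffsC bdiffs_zparts -!coefz_prod mulr1 big_map.
have -> : iota 1 k = index_iota 1 k.+1 by rewrite /index_iota subn1.
by rewrite mulrC qbinomK.
Qed.
End PartitionSeries.

(** * Asymptotics along an index close to alpha * a *)

Section Asymptotics.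
Variable R : realType.
Implicit Types (alpha x y : R) (c : int) (g : R -> R).

Definition pospart x : R := Num.max x 0.

Lemma pospart_ge0 x : 0 <= pospart x.
Proof. by rewrite le_max lexx orbT. Qed.

Lemma pospart_id x : 0 <= x -> pospart x = x.
Proof. by move=> /max_idPl. Qed.

Lemma pospart_eq0 x : x <= 0 -> pospart x = 0.
Proof. by move=> /max_idPr. Qed.

Lemma le_pospart x y : x <= y -> pospart x <= pospart y.
Proof. by move=> le_xy; rewrite ge_max !le_max le_xy lexx orbT. Qed.

Lemma pospart_dist x y : `|pospart x - pospart y| <= `|x - y|.
Proof.
wlog le_xy : x y / x <= y.
  by move=> IH; case/orP: (le_total x y) => /IH //; rewrite distrC (distrC y).
rewrite distrC (distrC x) !ger0_norm ?subr_ge0 ?le_pospart //.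
by rewrite /pospart; case: (lerP x 0); case: (lerP y 0); lra.
Qed.

Lemma exprS_dist (m : nat) x y (B : R) : 0 <= x <= B -> 0 <= y <= B ->
  `|x ^+ m.+1 - y ^+ m.+1| <= m.+1%:R * B ^+ m * `|x - y|.
Proof.
move=> /andP[x0 xB] /andP[y0 yB]; have B0 := le_trans x0 xB.
elim: m => [|m IHm]; first by rewrite !expr1 expr0 mulr1 mul1r.
have -> : x ^+ m.+2 - y ^+ m.+2 =
    x * (x ^+ m.+1 - y ^+ m.+1) + (x - y) * y ^+ m.+1.
  by rewrite (exprS x m.+1) (exprS y m.+1); ring.
apply: le_trans (ler_normD _ _) _; rewrite !normrM (ger0_norm x0).
rewrite [`|y ^+ _|]ger0_norm ?exprn_ge0 //.
have -> : m.+2%:R * B ^+ m.+1 * `|x - y| =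
    B * (m.+1%:R * B ^+ m * `|x - y|) + `|x - y| * B ^+ m.+1.
  by rewrite exprS -(natr1 m.+1); ring.
apply: lerD; first by apply: ler_pM.
by apply: ler_wpM2l => //; apply: lerXn2r; rewrite ?nnegrE.
Qed.

(** With the positive part, the sandwich holds for negative n as well, since the
exponent is nonzero; this spares any discussion of the sign of alpha. *)
Lemma zparts_bounds (m : nat) (n : int) :
  pospart n%:~R ^+ m.+1 <= zparts R m.+2 n * (m.+1`! * m.+2`!)%N%:R
    <= pospart (n%:~R + 'C(m.+3, 2)%:R) ^+ m.+1.
Proof.
have [n_lt0|] := ltrP n 0.
  rewrite /zparts zext_neg // mul0r pospart_eq0 ?lerz0 ?(ltW n_lt0) //.
  by rewrite expr0n lexx exprn_ge0 ?pospart_ge0.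
case: n => // n _; rewrite /zparts /zext !pospart_id //.
by rewrite -natrD -natrM -!natrX !ler_nat nparts_bounds.
Qed.

Lemma floor_sub_dist alpha c (a : nat) :
  `|(Num.floor (alpha * a%:R) - c)%:~R - alpha * a%:R| <= `|c%:~R| + 1.
Proof.
have /andP[] := floor_itv (alpha * a%:R); rewrite intrB intrD.
have := ler_norm (c%:~R : R); have := ler_norm (- c%:~R : R); rewrite normrN.
by rewrite ler_norml; lra.
Qed.

(** Both bounds of the sandwich are (m.+1)-th powers of positive parts of numbers
at bounded distance from alpha * a.  The estimate is for every real alpha,
because taking differences moves alpha into the negative range. *)
Lemma zparts_asymp (m : nat) alpha c : exists M : R, forall a : nat, (0 < a)%N ->
  `|zparts R m.+2 (Num.floor (alpha * a%:R) - c)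
    - (m.+1`! * m.+2`!)%N%:R^-1 * pospart alpha ^+ m.+1 * a%:R ^+ m.+1|
  <= M * a%:R ^+ m.
Proof.
set K : R := (_ * _)%N%:R; set s : R := 'C(m.+3, 2)%:R.
have K_gt0 : 0 < K by rewrite ltr0n muln_gt0 !fact_gt0.
have s_ge0 : 0 <= s by rewrite ler0n.
pose C := `|c%:~R| + 1 + s; have C_ge0 : 0 <= C by rewrite !addr_ge0.
exists (K^-1 * (m.+1%:R * (`|alpha| + C) ^+ m * C)) => a a_gt0.
have a_ge1 : (1 : R) <= a%:R by rewrite ler1n.
(* C bounds the distance to alpha * a of the bases of both bounds. *)
have near_pow y : `|y - alpha * a%:R| <= C ->
    `|pospart y ^+ m.+1 - (pospart alpha * a%:R) ^+ m.+1|
      <= m.+1%:R * (`|alpha| + C) ^+ m * C * a%:R ^+ m.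
  move=> yC; have -> : pospart alpha * a%:R = pospart (alpha * a%:R).
    by rewrite /pospart maxr_pMl ?mul0r.
  have alphaB : alpha * a%:R <= (`|alpha| + C) * a%:R.
    by rewrite ler_wpM2r // (le_trans (ler_norm alpha)) // lerDl.
  have B_ge0 : 0 <= (`|alpha| + C) * a%:R by rewrite mulr_ge0 // addr_ge0.
  have yB : y <= (`|alpha| + C) * a%:R.
    have := le_trans (ler_norm _) yC.
    have : alpha * a%:R <= `|alpha| * a%:R by rewrite ler_wpM2r // ler_norm.
    have : C <= C * a%:R by rewrite ler_peMr.
    by rewrite (mulrDl `|alpha|); lra.
  apply: le_trans (exprS_dist m _ _ ((`|alpha| + C) * a%:R) _ _) _.
  - by rewrite pospart_ge0 ge_max yB.
  - by rewrite pospart_ge0 ge_max alphaB.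
  rewrite exprMn mulrA -!mulrA; do 2!apply: ler_wpM2l => //.
    by rewrite exprn_ge0 // addr_ge0.
  rewrite mulrC ler_wpM2r ?exprn_ge0 //.
  exact: le_trans (pospart_dist _ _) yC.
set N := Num.floor _ - c.
have NC : `|N%:~R - alpha * a%:R| <= `|c%:~R| + 1 := floor_sub_dist alpha c a.
have lo : `|N%:~R - alpha * a%:R| <= C by apply: le_trans NC _; rewrite lerDl.
have hi : `|N%:~R + s - alpha * a%:R| <= C.
  rewrite addrAC; apply: le_trans (ler_normD _ _) _.
  by rewrite (ger0_norm s_ge0) lerD2r.
have {lo} := near_pow _ lo; have {hi} := near_pow _ hi.
have := zparts_bounds m N; rewrite -/K -/s => /andP[].
set z := zparts _ _ _; rewrite exprMn -[K^-1 * _ * a%:R ^+ m]mulrA.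
set e := _ * a%:R ^+ m.
have -> : z - K^-1 * pospart alpha ^+ m.+1 * a%:R ^+ m.+1
    = K^-1 * (z * K - pospart alpha ^+ m.+1 * a%:R ^+ m.+1).
  by rewrite mulrBr (mulrC z) mulKf ?gt_eqF // mulrA.
move: (pospart _ ^+ _) (pospart _ ^+ _) (pospart _ ^+ _ * _) => l u t lz zu ut lt_.
rewrite normrM (@ger0_norm _ K^-1) ?invr_ge0 ?(ltW K_gt0) //.
rewrite ler_wpM2l ?invr_ge0 ?(ltW K_gt0) //.
by move: lz zu ut lt_; rewrite !ler_norml; lra.
Qed.

(** The m-th backward difference with step 1, in expanded form. *)
Definition fdiff (m : nat) g x : R :=
  \sum_(i < m.+1) (-1) ^+ i * 'C(m, i)%:R * g (x - i%:R).

Lemma fdiffS (m : nat) g x : fdiff m.+1 g x = fdiff m g x - fdiff m g (x - 1).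
Proof.
rewrite /fdiff big_ord_recl [X in _ = X - _]big_ord_recl /= !bin0 -addrA.
congr (_ + _).
rewrite (eq_bigr (fun i : 'I_m.+1 =>
   (-1) ^+ i.+1 * 'C(m, i.+1)%:R * g (x - i.+1%:R) -
   (-1) ^+ i * 'C(m, i)%:R * g (x - 1 - i%:R))).
  rewrite sumrB; congr (_ - _).
  by rewrite big_ord_recr /= bin_small // mulr0 mul0r addr0.
move=> i _; rewrite /= /bump /= add1n binS natrD exprS.
have -> : x - 1 - i%:R = x - i.+1%:R by rewrite -natr1; ring.
ring.
Qed.

(** A step a + j takes the index floor(alpha a) - c to
floor((alpha - 1) a) - (c + j), an index of the same form: hence the estimate is
required for all alpha and c at once, and each step differences g in alpha. *)
Lemma bdiffs_asymp (f : int -> R) g (u v : nat -> R) :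
    (forall alpha c, exists M : R, forall a : nat, (0 < a)%N ->
       `|f (Num.floor (alpha * a%:R) - c) - g alpha * u a| <= M * v a) ->
  forall (js : seq nat) alpha c, exists M : R, forall a : nat, (0 < a)%N ->
    `|bdiffs [seq (a + j)%N | j <- js] f (Num.floor (alpha * a%:R) - c)
      - fdiff (size js) g alpha * u a| <= M * v a.
Proof.
move=> fg; elim=> [|j js IHjs] alpha c.
  by have [M fgM] := fg alpha c; exists M => a a_gt0; rewrite /fdiff big_ord1 /=
    bin0 expr0 !mul1r subr0 fgM.
have [M1 fgM1] := IHjs alpha c; have [M2 fgM2] := IHjs (alpha - 1) (c + j%:Z).
exists (M1 + M2) => a a_gt0; rewrite [size _]/= fdiffS /= /bdiff.
have -> : Num.floor (alpha * a%:R) - c - (a + j)%N%:Z =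
    Num.floor ((alpha - 1) * a%:R) - (c + j%:Z).
  have -> : (alpha - 1) * a%:R = alpha * a%:R + (- a%:Z)%:~R.
    by rewrite mulrBl mul1r rmorphN.
  by rewrite floorDrz ?intr_int // intrKfloor PoszD; move: (Num.floor _) => n; lia.
have := fgM1 a a_gt0; have := fgM2 a a_gt0; rewrite !ler_norml; lra.
Qed.

(** The sums have different ranges, but the terms i > alpha vanish because of the
positive part, and the terms i > m.+2 because of the binomial coefficient. *)
Lemma Ccoef_fdiff (m : nat) alpha : 0 <= alpha ->
  Ccoef alpha m.+2 = fdiff m.+2 (fun x => pospart x ^+ m.+1) alpha.
Proof.
move=> alpha_ge0.
pose t i : R := (-1) ^+ i * 'C(m.+2, i)%:R * pospart (alpha - i%:R) ^+ m.+1.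
set n := Num.truncn alpha; rewrite /fdiff /Ccoef -/n.
transitivity (\sum_(0 <= i < n.+1) t i).
  apply: eq_big_nat => i; rewrite ltnS => /andP[_ le_in].
  rewrite /t pospart_id // subr_ge0.
  by case/andP: (truncn_itv alpha_ge0) => + _; apply: le_trans; rewrite ler_nat.
rewrite (big_mkord xpredT t).
have tail p q : (forall i, (p <= i)%N -> t i = 0) -> (p <= q)%N ->
    \sum_(i < q) t i = \sum_(i < p) t i.
  move=> t0 le_pq; rewrite -!(big_mkord xpredT t) (big_cat_nat (leq0n p) le_pq) //=.
  by rewrite [X in _ + X]big_nat [X in _ + X]big1 ?addr0 // => i /andP[/t0].
have tn i : (n.+1 <= i)%N -> t i = 0.
  move=> lt_ni; rewrite /t pospart_eq0 ?expr0n ?mulr0 // subr_le0.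
  case/andP: (truncn_itv alpha_ge0) => _ /ltW/le_trans; apply.
  by rewrite ler_nat.
have tm i : (m.+3 <= i)%N -> t i = 0.
  by move=> lt_mi; rewrite /t bin_small // mulr0 mul0r.
by case/orP: (leq_total n.+1 m.+3) => [/(tail _ _ tn)|/(tail _ _ tm)].
Qed.

End Asymptotics.

(** * The case k = 1 *)

Lemma mulr_eventually_ge (R : realType) (b x : R) : 0 < b ->
  \forall a \near \oo, x <= b * a%:R.
Proof.
move=> b_gt0; near=> a; rewrite mulrC -ler_pdivrMr //; near: a.
exact: nbhs_infty_ger.
Unshelve. all: by end_near. Qed.

Lemma zparts1 (F : fieldType) (n : int) : zparts F 1 n = (0 <= n)%R%:R.
Proof. by case: n => // n; rewrite /zparts /zext nparts1. Qed.

Lemma Ccoef1 (R : realType) (alpha : R) : 0 <= alpha ->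
  Ccoef alpha 1 = (alpha < 1)%R%:R.
Proof.
move=> alpha_ge0; rewrite /Ccoef -[1]/(1%:R) -(truncn_lt_nat 1 alpha_ge0).
case: (Num.truncn alpha) => [|n]; first by rewrite big_nat1 expr0 !mul1r.
rewrite big_nat_recl // big_nat_recl // big1 => [|i _]; last first.
  by rewrite bin_small // mulr0 mul0r.
by rewrite !expr0 expr1 bin0 binn !mulr1 addr0 subrr.
Qed.

(** The coefficient is the indicator of 0 <= n minus that of a + 1 <= n.  For n
close to alpha * a each is eventually constant: by linear growth of the gap
unless alpha = 0 (first indicator) or alpha = 1 (second one), where the gap is
the constant -c or -c - 1. *)
Lemma coefz_qbinom1_near (R : realType) (alpha : R) (c : int) : 0 <= alpha ->
    (alpha = 0 -> c <= 0) -> (alpha = 1 -> c < 0) ->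
  \forall a \near \oo,
    coefz (qbinom R a 1) (Num.floor (alpha * a%:R) - c) = Ccoef alpha 1.
Proof.
move=> alpha_ge0 c0 c1; rewrite Ccoef1 //.
have left_in : \forall a \near \oo, 0 <= Num.floor (alpha * a%:R) - c.
  have [alpha_gt0|] := ltrP 0 alpha.
    near=> a; rewrite subr_ge0 floor_ge_int; near: a.
    exact: mulr_eventually_ge.
  move=> alpha_le0; have alpha0 : alpha = 0 by apply/le_anti/andP.
  by near=> a; rewrite alpha0 mul0r floor0 sub0r oppr_ge0 c0.
have right_in : \forall a \near \oo,
    (0 <= Num.floor (alpha * a%:R) - c - (a + 1)%N%:Z) = (1 <= alpha).
  have floorE (a : nat) : (0 <= Num.floor (alpha * a%:R) - c - (a + 1)%N%:Z) =
      (c%:~R + 1 <= (alpha - 1) * a%:R).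
    rewrite -addrA -opprD subr_ge0 floor_ge_int intrD PoszD intrD.
    by rewrite mulrBl mul1r lerBrDr addrAC addrA addrAC -addrA.
  have [alpha_gt1|alpha_lt1|alpha1] := ltrgtP 1 alpha.
  - near=> a; rewrite floorE; near: a.
    by apply: mulr_eventually_ge; rewrite subr_gt0.
  - near=> a; rewrite floorE; apply/negbTE; rewrite -ltNge -ltrN2 -mulNr opprB.
    apply: (@lt_le_trans _ _ (- (c%:~R + 1) + 1)); first by rewrite ltrDl.
    near: a; by apply: mulr_eventually_ge; rewrite subr_gt0.
  - near=> a; rewrite floorE -alpha1 subrr mul0r.
    have : c + 1 <= 0 by have := c1 (esym alpha1); lia.
    by rewrite -(ler_int R) intrD.
near=> a; rewrite coefz_qbinom /= /bdiff /= !zparts1.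
rewrite (near left_in a) // (near right_in a) //.
by case: ltP => _; rewrite ?subr0 ?subrr.
Unshelve. all: by end_near. Qed.

(** * The asymptotic formula *)

(* The exponent k - 2 is an integer exponent (it is -1 when k = 1).  For k = 1
   the claim fails when alpha = 0 < c and when alpha = 1, 0 <= c: there the
   coefficient and C(alpha, 1) are the two different values among 0 and 1.
   [hk1] excludes exactly these cases and says nothing for k >= 2. *)
Theorem theorem2p4 (R : realType) (alpha : R) (halpha : 0 <= alpha)
    (c : int) (k : nat) (hk : (0 < k)%N)
    (hk1 : k = 1%N -> (alpha = 0 -> c <= 0) /\ (alpha = 1 -> c < 0)) :
  (fun a : nat =>
     (coefz (qbinom R a k) (Num.floor (alpha * a%:R) - c) : R^o))
  = (fun a : nat =>
       ((((k.-1)`! * k`!)%N%:R)^-1 * Ccoef alpha k * a%:R ^+ k.-1 : R^o))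
    +O_\oo (fun a : nat => (a%:R ^ (k%:Z - 2) : R^o)).
Proof.
apply/eqaddOP; case: k hk hk1 => [//|[|m]] _ hk1.
  have [c0 c1] := hk1 erefl.
  have eq1 := coefz_qbinom1_near R alpha c halpha c0 c1.
  near=> M; near=> a; rewrite /= !fctE (near eq1 a) //.
  rewrite !fact0 invr1 !mul1r expr0 mulr1 subrr normr0 mulr_ge0 //.
set w : R := (_ * _)%N%:R^-1.
have [M coefM] := bdiffs_asymp R (zparts R m.+2)
  (fun x => w * pospart R x ^+ m.+1) (fun a => a%:R ^+ m.+1)
  (fun a => a%:R ^+ m) (zparts_asymp R m) (iota 1 m.+2) alpha c.
near=> M'; near=> a.
have a_gt0 : (0 < a)%N by near: a; exact: nbhs_infty_gt.
have -> : m.+2%:Z - 2 = m%:Z by lia.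
rewrite -exprnP /= [`|_ ^+ _|]ger0_norm ?exprn_ge0 //.
apply: le_trans (_ : M * a%:R ^+ m <= _); last first.
  by rewrite ler_wpM2r ?exprn_ge0 //; near: M'; exact: nbhs_pinfty_ge.
have := coefM a a_gt0; rewrite -coefz_qbinom size_iota.
suff -> : fdiff R m.+2 (fun x => w * pospart R x ^+ m.+1) alpha
    = w * Ccoef alpha m.+2.
  by [].
rewrite Ccoef_fdiff // /fdiff mulr_sumr; apply: eq_bigr => i _; ring.
Unshelve. all: by end_near. Qed.
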